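(* Let $E$ be a Euclidean vector space with $\dim E\geq 2$ and let $m_1,\dots,m_N>0$ be masses, $N\ge 2$. Let $u:E^N\to\mathbb{R}$ be a weak KAM solution of the Newtonian $N$-body problem in $E$ with these masses. Then $u$ is translation invariant: $$u(r_1,\dots,r_N)=u(r_1+r,\dots,r_N+r)$$ for every configuration $x=(r_1,\dots,r_N)\in E^N$ and every $r\in E$.
   Context: $E$ is a finite-dimensional real vector space with inner product $\langle\cdot,\cdot\rangle$ and associated norm $\|\cdot\|$. For $x=(r_1,\dots,r_N)\in E^N$, the Newtonian potential is $U(x)=\sum_{1\le i<j\le N}\frac{m_im_j}{\|r_i-r_j\|}\in(0,+\infty]$, with $U(x)=+\infty$ if $r_i=r_j$ for some $i<j$. The mass inner product on $E^N$ is $x\cdot y=\sum_{i=1}^N m_i\langle r_i,s_i\rangle$ for $x=(r_1,\dots,r_N)$, $y=(s_1,\dots,s_N)$, with norm $|v|=(v\cdot v)^{1/2}$. The Lagrangian is $L(x,v)=\frac12|v|^2+U(x)$, and the action of an absolutely continuous curve $\gamma:[a,b]\to E^N$ is $A(\gamma)=\int_a^b L(\gamma(t),\dot\gamma(t))\,dt\in(0,+\infty]$. For $x,y\in E^N$ and $T>0$, $\phi(x,y,T)$ is the minimum of $A(\gamma)$ over all absolutely continuous curves $\gamma:[0,T]\to E^N$ with $\gamma(0)=x$, $\gamma(T)=y$. The action potential is $\phi(x,y)=\inf_{T>0}\phi(x,y,T)$. The set of dominated functions is $\mathcal{H}=\{u:E^N\to\mathbb{R}\mid u(y)-u(x)\le\phi(x,y)\text{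 for all }x,y\in E^N\}$. The Lax-Oleinik semigroup $(T_t)_{t\ge0}$ acts on $\mathcal{H}$ by $T_tu(x)=\inf\{u(y)+\phi(y,x,t)\mid y\in E^N\}$ for $t>0$ and $T_0u=u$. A weak KAM solution is a function $u\in\mathcal{H}$ such that $T_tu=u$ for all $t\ge0$. *)

(* Defs.v *)
(* MathComp / MathComp-Analysis *)
From HB Require Import structures.
From mathcomp Require Import all_boot all_order all_algebra sesquilinear.
From mathcomp Require Import all_classical all_reals all_analysis.

Set Implicit Arguments.
Unset Strict Implicit.
Unset Printing Implicit Defensive.

Import Order.TTheory GRing.Theory Num.Theory.
Import numFieldNormedType.Exports.

Local Open Scope classical_set_scope.
Local Open Scope ring_scope.

(* A bare vectType carries no topology, so differentiability and absolute
   continuity are stated with respect to an explicit norm [nrm]. *)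
Section curves.
Variables (R : realType) (V : lmodType R) (nrm : V -> R).
Implicit Types (gamma : R -> V) (t a b : R).

Definition has_velocity gamma t (v : V) : Prop :=
  nrm (h^-1 *: (gamma (t + h) - gamma t) - v) @[h --> (0 : R)^'] --> (0 : R).

(* The derivative where it exists, and 0 elsewhere: the default value is
   irrelevant for an absolutely continuous curve, which is differentiable
   almost everywhere when V is finite-dimensional. *)
Definition velocity gamma t : V := xget 0 [set v | has_velocity gamma t v].

(* Only the values of gamma on [a, b] matter. *)
Definition abs_continuous a b gamma : Prop :=
  forall eps : R, 0 < eps -> exists2 delta : R, 0 < delta &
    forall (n : nat) (s t : 'I_n -> R),
      (forall i, [/\ a <= s i, s i <= t i & t i <= b]) ->
      trivIset [set: 'I_n] (fun i => `]s i, t i[%classic) ->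
      \sum_(i < n) (t i - s i) < delta ->
      \sum_(i < n) nrm (gamma (t i) - gamma (s i)) < eps.

End curves.

Section nbody.
Variables (R : realType) (E : vectType R) (ip : {dot E for idfun}).
Variables (N : nat) (m : 'I_N -> R).

Local Notation config := {ffun 'I_N -> E}.

Definition enorm (r : E) : R := Num.sqrt (ip r r).

Definition potential (x : config) : \bar R :=
  (\sum_(i < N) \sum_(j < N | (i < j)%N)
     if x i == x j then +oo else (m i * m j / enorm (x i - x j))%:E)%E.

Definition mass_inner (x y : config) : R := \sum_(i < N) m i * ip (x i) (y i).

Definition mass_norm (v : config) : R := Num.sqrt (mass_inner v v).

Definition lagrangian (x v : config) : \bar R :=
  ((2^-1 * mass_norm v ^+ 2)%:E + potential x)%E.

Definition action (a b : R) (gamma : R -> config) : \bar R :=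
  (\int[@lebesgue_measure R]_(t in `[a, b])
     lagrangian (gamma t) (velocity mass_norm gamma t))%E.

Definition curves_between (x y : config) (T : R) : set (R -> config) :=
  [set gamma | [/\ abs_continuous mass_norm 0 T gamma,
                   gamma 0 = x & gamma T = y]].

(* Written as an infimum; for T > 0 it is attained, by Tonelli's theorem. *)
Definition fixed_time_potential (x y : config) (T : R) : \bar R :=
  ereal_inf [set action 0 T gamma | gamma in curves_between x y T].

Definition action_potential (x y : config) : \bar R :=
  ereal_inf [set fixed_time_potential x y T | T in [set T : R | 0 < T]].

Definition dominated (u : config -> R) : Prop :=
  forall x y, ((u y - u x)%:E <= action_potential x y)%E.

Definition lax_oleinik (t : R) (u : config -> R) (x : config) : \bar R :=
  if t == 0 then (u x)%:E
  else ereal_inf [set ((u y)%:E + fixed_time_potential y x t)%E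
                 | y in [set: config]].

Definition weak_KAM (u : config -> R) : Prop :=
  dominated u /\
  forall t : R, 0 <= t -> forall x, lax_oleinik t u x = (u x)%:E.

End nbody.

(* Main.v *)
(* Restricted to the translates of a configuration, a weak KAM solution u is
   concave: drifting an almost minimizing curve of duration t towards x + w and
   towards x - l w changes the actions by terms which cancel in the convex
   combination, up to O(1/t), and t is arbitrary.  A concave function that
   decreases at most sublinearly along every line is constant.  Without
   collisions in x, domination gives such a bound: spread the bodies by a
   dilation, translate at low potential energy, and contract back.  An almost
   minimizing curve has finite action, hence visits non-collision
   configurations; comparing with one of them bounds u from below on the
   translates of the starting point, and translating the whole curve carries
   the invariance to its end point. *)
Require Import Defs.
From HB Require Import structures.
From mathcomp Require Import all_boot all_order all_algebra sesquilinear.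
From mathcomp Require Import all_classical all_reals all_analysis.
From mathcomp Require Import measurable_realfun ring lra.
Import Order.TTheory GRing.Theory Num.Theory.
Import numFieldNormedType.Exports.
Local Open Scope ring_scope.
Local Open Scope classical_set_scope.

(** * Lower integrals of nonnegative functions *)

Section lower_integral.
Set Implicit Arguments.
Unset Strict Implicit.
Import HBNNSimple.

(** The integral is a supremum over simple functions below the extension by zero; those admissible
    for [f] on [D] are admissible for [g] on [D']. *)
Lemma lower_integral_le (d : measure_display) (T : measurableType d)
    (R : realType) (mu : {measure set T -> \bar R}) (D D' : set T)
    (f g : T -> \bar R) :
  D `<=` D' ->
  (forall x, D x -> 0 <= f x)%E -> (forall x, D' x -> 0 <= g x)%E ->
  (forall x, D x -> f x <= g x)%E ->
  (\int[mu]_(x in D) f x <= \int[mu]_(x in D') g x)%E.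
Proof.
move=> DD' f0 g0 fg; rewrite !ge0_integralE//.
apply: ereal_sup_le => _ [h /= hf <-]; exists h => //= x.
apply: le_trans (hf x) _; rewrite /patch.
have [/set_mem Dx|_] := boolP (x \in D).
  by rewrite mem_set ?fg//; apply: DD'.
by have [/set_mem/g0|//] := boolP (x \in D').
Qed.

(** A simple function nearly attaining the supremum is a measurable minorant, for which the integral
    is additive. *)
Lemma lower_integral_approx (d : measure_display) (T : measurableType d)
    (R : realType) (mu : {measure set T -> \bar R}) (D : set T)
    (f : T -> \bar R) (a : R) :
  measurable D -> (forall x, D x -> 0 <= f x)%E ->
  (a%:E < \int[mu]_(x in D) f x)%E ->
  exists h : T -> R, [/\ measurable_fun D h, forall x, 0 <= h x,
    forall x, D x -> ((h x)%:E <= f x)%E &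
    (a%:E < \int[mu]_(x in D) (h x)%:E)%E].
Proof.
move=> mD f0; rewrite ge0_integralE// => /ereal_sup_gt[_ [h /= hf <-] ah].
exists h; split.
- exact: measurable_funTS.
- by move=> x; exact: fun_ge0.
- by move=> x Dx; have := hf x; rewrite /patch mem_set.
rewrite integral_nnsfun//; apply: lt_le_trans ah _.
rewrite (_ : _ \_ _ = h)//; apply/funext => x; rewrite /patch.
have [//|xD] := boolP (x \in D); apply/esym/eqP.
rewrite eq_le fun_ge0 andbT -lee_fin.
by have := hf x; rewrite /patch (negPf xD).
Qed.

(* For functions that may fail to be measurable, [\int] of a nonnegative
   function is a lower integral, and lower integrals are superadditive. *)
Lemma lower_integral_convex (d : measure_display) (T : measurableType d)
    (R : realType) (mu : {measure set T -> \bar R}) (D : set T)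
    (f g k : T -> \bar R) (l c a b e M : R) :
  measurable D -> mu D = M%:E ->
  (forall x, D x -> 0 <= f x)%E -> (forall x, D x -> 0 <= g x)%E ->
  (forall x, D x -> 0 <= k x)%E -> 0 <= l -> 0 <= c ->
  (forall x, D x -> l%:E * f x + g x <= (1 + l)%:E * k x + c%:E)%E ->
  (a%:E <= \int[mu]_(x in D) f x)%E -> (b%:E <= \int[mu]_(x in D) g x)%E ->
  (\int[mu]_(x in D) k x <= e%:E)%E ->
  l * a + b <= (1 + l) * e + c * M.
Proof.
move=> mD muD f0 g0 k0 l0 c0 fgk af bg ke; apply/ler_addgt0Pr => z z0.
have l1 : 0 < 1 + l by apply: ltr_wpDr.
have Mge0 : 0 <= M by rewrite -lee_fin -muD.
(* The two minorants lose [z'] each, with weights [l] and [1], hence [z] in all. *)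
pose z' := z / (1 + l); have z'0 : 0 < z' by rewrite divr_gt0.
have [|h1 [mh1 h10 h1f ah1]] :=
  @lower_integral_approx _ _ _ mu _ _ (a - z') mD f0.
  by apply: lt_le_trans af; rewrite lte_fin ltrBlDr ltrDl.
have [|h2 [mh2 h20 h2g bh2]] :=
  @lower_integral_approx _ _ _ mu _ _ (b - z') mD g0.
  by apply: lt_le_trans bg; rewrite lte_fin ltrBlDr ltrDl.
(* Solving the pointwise inequality for [k] and truncating at 0 gives a measurable minorant of
   [k]. *)
pose H x := Num.max 0 ((l * h1 x + h2 x - c) / (1 + l)).
have H0 x : 0 <= H x by rewrite /H le_max lexx.
have mG : measurable_fun D (fun x => l * h1 x + h2 x).
  by apply: measurable_funD => //; apply: measurable_funM.
have mH : measurable_fun D H.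
  apply: measurable_maxr => //; apply: measurable_funM => //.
  exact: measurable_funB.
have Hk x : D x -> ((H x)%:E <= k x)%E.
  move=> Dx; rewrite /H EFin_max ge_max k0//=.
  have := fgk _ Dx; have := h1f _ Dx; have := h2g _ Dx; have := k0 _ Dx.
  case: (k x) => [r _ h2gx h1fx|_ _ _ _|//]; last by rewrite leey.
  rewrite -EFinM -EFinD => fgr.
  rewrite lee_fin ler_pdivrMr// lerBlDr [r * _]mulrC -lee_fin.
  apply: le_trans fgr; rewrite EFinD EFinM.
  by apply: leeD => //; apply: lee_wpmul2l.
have GH x : l * h1 x + h2 x <= (1 + l) * H x + c.
  by rewrite -lerBlDr [_ * H x]mulrC -ler_pdivrMr// /H le_max lexx orbT.
have : (l%:E * \int[mu]_(x in D) (h1 x)%:E + \int[mu]_(x in D) (h2 x)%:E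
    <= (1 + l)%:E * e%:E + c%:E * mu D)%E.
  have -> : (l%:E * \int[mu]_(x in D) (h1 x)%:E + \int[mu]_(x in D) (h2 x)%:E
      = \int[mu]_(x in D) (l * h1 x + h2 x)%:E)%E.
    rewrite -ge0_integralZl_EFin//=; last 2 first.
    - by move=> x _; rewrite lee_fin.
    - exact/measurable_EFinP.
    rewrite -ge0_integralD//=; last 4 first.
    - by move=> x _; rewrite lee_fin mulr_ge0.
    - by apply/measurable_EFinP; apply: measurable_funM.
    - by move=> x _; rewrite lee_fin.
    - exact/measurable_EFinP.
  apply: (@le_trans _ _ (\int[mu]_(x in D) (((1 + l) * H x) + c)%:E)%E).
    apply: lower_integral_le => // x _; rewrite lee_fin//.
    - by rewrite addr_ge0// mulr_ge0.
    - by rewrite addr_ge0// mulr_ge0// ltW.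
  under eq_integral do rewrite EFinD EFinM.
  rewrite ge0_integralD//=; last 2 first.
  - by move=> x _; rewrite lee_fin mulr_ge0// ltW.
  - by apply/measurable_EFinP; apply: measurable_funM.
  rewrite integral_cst// leeD2r//.
  rewrite ge0_integralZl_EFin//=; last 3 first.
  - by move=> x _; rewrite lee_fin.
  - exact/measurable_EFinP.
  - exact: ltW.
  rewrite lee_pmul2l ?lte_fin//; apply: le_trans ke.
  by apply: lower_integral_le => // x _; rewrite lee_fin.
rewrite muD -!EFinM -EFinD => le_e.
have : ((l * (a - z') + (b - z'))%:E <= ((1 + l) * e + c * M)%:E)%E.
  apply: le_trans le_e; rewrite EFinD EFinM; apply: leeD; last exact: ltW.
  by apply: lee_wpmul2l; [rewrite lee_fin | exact: ltW].
rewrite lee_fin; have -> : z = (1 + l) * z' by rewrite mulrC divfK ?gt_eqF.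
by lra.
Qed.

End lower_integral.

(** * The mass inner product and its norm *)

Section mass_geometry.
Set Implicit Arguments.
Unset Strict Implicit.
Variables (R : realType) (E : vectType R) (ip : {dot E for idfun}).
Variables (N : nat) (m : 'I_N -> R).
Hypothesis m_gt0 : forall i, 0 < m i.

Local Notation config := {ffun 'I_N -> E}.
Implicit Types (x y v w a : config) (gamma : R -> config).
Local Notation q v := (mass_inner ip m v v).
Local Notation nrm := (mass_norm ip m).
Local Notation U := (potential ip m).

Lemma ipZl (c : R) (r s : E) : ip (c *: r) s = c * ip r s.
Proof. by rewrite linearZl_LR. Qed.

Lemma ipZr (c : R) (r s : E) : ip r (c *: s) = c * ip r s.
Proof. by rewrite linearZr_LR. Qed.

Lemma ip_ge0 (r : E) : 0 <= ip r r.
Proof.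
have [->|r0] := eqVneq r 0; first by rewrite linear0l.
exact/ltW/neq0_dnorm_gt0.
Qed.

Lemma enormZ (c : R) (r : E) : enorm ip (c *: r) = `|c| * enorm ip r.
Proof.
by rewrite /enorm ipZl ipZr mulrA -expr2 sqrtrM ?sqr_ge0// sqrtr_sqr.
Qed.

Lemma mass_inner_ge0 v : 0 <= q v.
Proof. by apply: sumr_ge0 => i _; rewrite mulr_ge0 ?ip_ge0// ltW. Qed.

Lemma mass_norm_ge0 v : 0 <= nrm v. Proof. exact: sqrtr_ge0. Qed.

Lemma mass_norm_sqr v : nrm v ^+ 2 = q v.
Proof. by rewrite sqr_sqrtr// mass_inner_ge0. Qed.

Lemma mass_innerZ (c : R) v : q (c *: v) = c ^+ 2 * q v.
Proof.
rewrite /mass_inner mulr_sumr; apply: eq_bigr => i _.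
by rewrite ffunE ipZl ipZr; ring.
Qed.

Lemma mass_normZ (c : R) v : nrm (c *: v) = `|c| * nrm v.
Proof. by rewrite /mass_norm mass_innerZ sqrtrM ?sqr_ge0// sqrtr_sqr. Qed.

Lemma mass_norm_eq0 v : nrm v = 0 -> v = 0.
Proof.
move=> /eqP; rewrite sqrtr_eq0 => qv; apply/ffunP => i; rewrite ffunE.
apply/eqP; apply: contraTT qv => vi; rewrite -ltNge /mass_inner (bigD1 i)//=.
rewrite ltr_pwDl//; first by rewrite mulr_gt0// neq0_dnorm_gt0.
by apply: sumr_ge0 => j _; rewrite mulr_ge0 ?ip_ge0// ltW.
Qed.

(** The cross terms cancel; [l = 1] is the parallelogram identity. *)
Lemma mass_inner_convex (l : R) v a :
  l * q (v + a) + q (v - l *: a) = (1 + l) * q v + l * (1 + l) * q a.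
Proof.
rewrite /mass_inner !mulr_sumr -!big_split /=; apply: eq_bigr => i _.
rewrite !ffunE !(linearDl, linearDr, linearNl, linearNr) /=.
rewrite !(ipZl, ipZr); ring.
Qed.

(* The crude constant 2 follows from the parallelogram identity alone. *)
Lemma mass_normD_le v w : nrm (v + w) <= 2 * (nrm v + nrm w).
Proof.
have n0 := mass_norm_ge0.
rewrite -(@ler_pXn2r _ 2)// ?nnegrE ?mulr_ge0 ?addr_ge0//.
have := mass_inner_convex 1 v w; rewrite scale1r exprMn -!mass_norm_sqr.
have := sqr_ge0 (nrm (v - w)); have := sqr_ge0 (nrm v); have := sqr_ge0 (nrm w).
have := mulr_ge0 (n0 v) (n0 w); nra.
Qed.

(** * Velocities and absolutely continuous curves *)

Lemma has_velocity_unique gamma t v w :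
  has_velocity nrm gamma t v -> has_velocity nrm gamma t w -> v = w.
Proof.
move=> hv hw; apply/subr0_eq/mass_norm_eq0/le_anti.
rewrite mass_norm_ge0 andbT.
pose f z (h : R) := nrm (h^-1 *: (gamma (t + h) - gamma t) - z).
have h0 : 2 * (f v h + f w h) @[h --> (0 : R)^'] --> 2 * (0 + 0 : R).
  apply: cvgM; first exact: cvg_cst.
  exact: (@cvgD _ _ _ _ _ (f v) (f w) 0 0 hv hw).
rewrite addr0 mulr0 in h0.
rewrite -(cvg_lim _ h0)//; apply: limr_ge; first exact/cvgP/h0.
near=> h; rewrite /f; set y := h^-1 *: _.
have -> : v - w = (y - w) + (-1) *: (y - v).
  by rewrite scaleN1r opprB [RHS]addrC addrA subrK.
apply: le_trans (mass_normD_le _ _) _.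
by rewrite mass_normZ normrN1 mul1r addrC.
Unshelve. all: by end_near. Qed.

Lemma has_velocity_drift gamma t v w : has_velocity nrm gamma t v ->
  has_velocity nrm (fun s => gamma s + s *: w) t (v + w).
Proof.
apply: cvg_trans; apply: near_eq_cvg; near=> h.
have h0 : h != 0 by near: h; exact: nbhs_dnbhs_neq.
congr nrm; rewrite scalerDl opprD addrACA (addrC (t *: w)) addrK.
rewrite [_ *: (_ + h *: w)]scalerDr scalerA mulVf// scale1r.
by rewrite opprD addrACA subrr addr0.
Unshelve. all: by end_near. Qed.

Lemma velocity_eq gamma t v :
  has_velocity nrm gamma t v -> velocity nrm gamma t = v.
Proof.
move=> hv; apply: (@has_velocity_unique gamma t _ _ _ hv).
exact: (@xgetPex _ 0 [set v | has_velocity nrm gamma t v] (ex_intro _ v hv)).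
Qed.

Lemma velocity_default gamma t :
  ~ (exists v, has_velocity nrm gamma t v) -> velocity nrm gamma t = 0.
Proof. by move=> hv; apply: xgetPN => v hgv; apply: hv; exists v. Qed.

(** Drifting back by [- w] recovers [gamma], so at [t] either all drifted curves have a velocity or
    none has; in the latter case [velocity] takes its default value 0. *)
Lemma velocity_drift_cases gamma t :
  (forall w, velocity nrm (fun s => gamma s + s *: w) t =
             velocity nrm gamma t + w) \/
  (forall w, velocity nrm (fun s => gamma s + s *: w) t = 0).
Proof.
have [[v hv]|nv] := pselect (exists v, has_velocity nrm gamma t v).
  by left=> w; rewrite (velocity_eq hv); exact/velocity_eq/has_velocity_drift.
right=> w; apply: velocity_default => -[v hv].
have gK : (fun s => gamma s + s *: w + s *: (- w)) = gamma.
  by apply/funext => s; rewrite scalerN addrK.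
have := has_velocity_drift (- w) hv; rewrite gK => hv'.
by apply: nv; exists (v - w).
Qed.

Lemma abs_continuous_cst (a b : R) x : abs_continuous nrm a b (fun=> x).
Proof.
move=> e e0; exists 1 => // n s t _ _ _; rewrite big1// => i _.
by rewrite subrr -(scale0r 0) mass_normZ normr0 mul0r.
Qed.

Lemma abs_continuous_drift (a b : R) gamma w : abs_continuous nrm a b gamma ->
  abs_continuous nrm a b (fun s => gamma s + s *: w).
Proof.
move=> ac e e0; have e40 : 0 < e / 4 by lra.
have [d d0 acd] := ac _ e40.
have w1 : 0 < 4 * (nrm w + 1) by rewrite mulr_gt0// ltr_wpDl// mass_norm_ge0.
(* The curve and the drift contribute less than [e / 4] each, doubled by the constant of
   [mass_normD_le]; the [+ 1] covers [nrm w = 0]. *)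
exists (Num.min d (e / (4 * (nrm w + 1)))).
  by rewrite lt_min d0 divr_gt0.
move=> n s t st tr; rewrite lt_min => /andP[std].
rewrite ltr_pdivlMr// => stw.
have := acd n s t st tr std.
have S0 : 0 <= \sum_(i < n) (t i - s i).
  by apply: sumr_ge0 => i _; have [_ si _] := st i; rewrite subr_ge0.
have : \sum_(i < n) nrm (gamma (t i) + t i *: w - (gamma (s i) + s i *: w)) <=
   2 * (\sum_(i < n) nrm (gamma (t i) - gamma (s i)) +
        nrm w * \sum_(i < n) (t i - s i)).
  rewrite mulr_sumr -big_split mulr_sumr; apply: ler_sum => i _.
  rewrite opprD addrACA -scalerBl; apply: le_trans (mass_normD_le _ _) _.
  have [_ si _] := st i.
  by rewrite mass_normZ ger0_norm ?subr_ge0// [nrm w * _]mulrC.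
have := mulr_ge0 (mass_norm_ge0 w) S0; nra.
Qed.

Lemma abs_continuous_sub (a b b' : R) gamma : b' <= b ->
  abs_continuous nrm a b gamma -> abs_continuous nrm a b' gamma.
Proof.
move=> bb ac e /ac[d d0 acd]; exists d => // n s t st; apply: acd => i.
by have [? ? tb] := st i; split => //; apply: le_trans bb.
Qed.

(** * Potential, Lagrangian and action under translation, dilation and drift *)

Lemma potential_ge0 x : (0 <= U x)%E.
Proof.
apply: sume_ge0 => i _; apply: sume_ge0 => j _; case: ifPn => [_|xij].
  by rewrite leey.
by rewrite lee_fin !mulr_ge0 ?invr_ge0 ?sqrtr_ge0// ltW.
Qed.

Lemma potential_translation x w :
  (forall i j, w i = w j) -> U (x + w) = U x.
Proof.
move=> wc; apply: eq_bigr => i _; apply: eq_bigr => j _.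
by rewrite !ffunE (wc j i) (inj_eq (addIr _)) opprD addrACA subrr addr0.
Qed.

Lemma potentialZ (c : R) x : 0 < c -> U (c *: x) = ((c^-1)%:E * U x)%E.
Proof.
move=> c0; have ci : 0 < c^-1 by rewrite invr_gt0.
rewrite [in RHS]/potential ge0_sume_distrr; last first.
  move=> i _; apply: sume_ge0 => j _; case: ifPn => [_|xij].
    by rewrite leey.
  by rewrite lee_fin !mulr_ge0 ?invr_ge0 ?sqrtr_ge0// ltW.
apply: eq_bigr => i _; rewrite ge0_sume_distrr; last first.
  move=> j _; case: ifPn => [_|xij]; first by rewrite leey.
  by rewrite lee_fin !mulr_ge0 ?invr_ge0 ?sqrtr_ge0// ltW.
apply: eq_bigr => j _; rewrite !ffunE.
rewrite (inj_eq (scalerI (lt0r_neq0 c0))); case: ifPn => [_|xij].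
  by rewrite gt0_muley ?lte_fin.
by rewrite -scalerBr enormZ gtr0_norm// invfM -EFinM; congr EFin; ring.
Qed.

Lemma lagrangian_ge0 x v : (0 <= lagrangian ip m x v)%E.
Proof.
by rewrite adde_ge0 ?potential_ge0// lee_fin mulr_ge0 ?invr_ge0 ?sqr_ge0.
Qed.

Lemma has_velocity_translation gamma t w v :
  has_velocity nrm (fun s => gamma s + w) t v <-> has_velocity nrm gamma t v.
Proof.
rewrite /has_velocity; set F := (X in X @ _ --> _).
rewrite (_ : F = fun h => nrm (h^-1 *: (gamma (t + h) - gamma t) - v))//.
by apply/funext => h; rewrite /F opprD addrACA subrr addr0.
Qed.

Lemma velocity_translation gamma t w :
  velocity nrm (fun s => gamma s + w) t = velocity nrm gamma t.
Proof.
rewrite /velocity; congr xget; apply/funext => v; apply/propext.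
exact: has_velocity_translation.
Qed.

Lemma abs_continuous_translation (a b : R) gamma w :
  abs_continuous nrm a b gamma ->
  abs_continuous nrm a b (fun s => gamma s + w).
Proof.
move=> ac e /ac[d d0 acd]; exists d => // n s t st tr std.
under eq_bigr do rewrite opprD addrACA subrr addr0.
exact: acd.
Qed.

Lemma action_translation (a b : R) gamma w : (forall i j, w i = w j) ->
  action ip m a b (fun s => gamma s + w) = action ip m a b gamma.
Proof.
move=> wc; apply: eq_integral => t _.
by rewrite /lagrangian velocity_translation potential_translation.
Qed.

(** Where velocities exist this is the equality [mass_inner_convex]; elsewhere the drifted
    velocities are 0 and the left side vanishes. *)
Lemma velocity_drift_convex gamma s (l : R) w : 0 <= l ->
  l * q (velocity nrm (fun s => gamma s + s *: w) s) +
    q (velocity nrm (fun s => gamma s + s *: (- (l *: w))) s) <=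
  (1 + l) * q (velocity nrm gamma s) + l * (1 + l) * q w.
Proof.
move=> l0; case: (velocity_drift_cases gamma s) => vd.
  by rewrite (vd w) (vd (- (l *: w))) mass_inner_convex.
rewrite (vd w) (vd (- (l *: w))) -(scale0r w) mass_innerZ expr0n/= !mul0r.
by rewrite mulr0 addr0 addr_ge0 ?mulr_ge0 ?addr_ge0 ?mass_inner_ge0.
Qed.

(** The potential has total weight [1 + l] on both sides, so the kinetic terms decide; at a
    collision the right side is infinite. *)
Lemma lagrangian_convex (l c : R) x v x1 v1 x2 v2 : 0 <= l ->
  U x1 = U x -> U x2 = U x ->
  l * q v1 + q v2 <= (1 + l) * q v + 2 * c ->
  (l%:E * lagrangian ip m x1 v1 + lagrangian ip m x2 v2 <=
    (1 + l)%:E * lagrangian ip m x v + c%:E)%E.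
Proof.
move=> l0 U1 U2; rewrite /lagrangian U1 U2 !mass_norm_sqr.
have := potential_ge0 x; case: (U x) => [P _|_ _|//].
  by rewrite -!EFinD lee_fin; lra.
rewrite [leRHS](_ : _ = +oo%E) ?leey// addey// gt0_muley//.
by rewrite lte_fin ltr_wpDr.
Qed.

Variable u : config -> R.

(** * Dominated functions *)

Section dominated.
Hypothesis u_dom : dominated ip m u.

Lemma dominated_action (T : R) gamma : 0 < T -> abs_continuous nrm 0 T gamma ->
  ((u (gamma T) - u (gamma 0))%:E <= action ip m 0 T gamma)%E.
Proof.
move=> T0 ac; apply: le_trans (u_dom _ _) _.
apply: (@le_trans _ _ (fixed_time_potential ip m (gamma 0) (gamma T) T)).
  by apply: ereal_inf_lbound; exists T.
by apply: ereal_inf_lbound; exists gamma.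
Qed.

(** The test curve is the uniform motion with velocity [w]. *)
Lemma dominated_line (T B : R) x w : 0 < T ->
  (forall s, 0 <= s <= T -> (U (x + s *: w)%R <= B%:E)%E) ->
  u (x + T *: w) - u x <= T * (2^-1 * q w + B).
Proof.
move=> T0 UB; pose gamma s := x + s *: w.
have vg s : velocity nrm gamma s = w.
  apply: velocity_eq; rewrite -[w]add0r; apply: has_velocity_drift.
  rewrite /has_velocity; set F := (X in X @ _ --> _).
  rewrite (_ : F = fun=> 0); first exact: cvg_cst.
  apply/funext => h; rewrite /F !subrr scaler0 subr0.
  by rewrite -(scale0r 0) mass_normZ normr0 mul0r.
have acg : abs_continuous nrm 0 T gamma.
  exact/abs_continuous_drift/abs_continuous_cst.
have B0 : 0 <= B.
  rewrite -lee_fin; apply: le_trans (UB 0 _); first exact: potential_ge0.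
  by rewrite lexx ltW.
have := dominated_action T0 acg.
rewrite {1 2}/gamma scale0r addr0 -lee_fin => /le_trans; apply.
have : (action ip m 0 T gamma <=
    \int[@lebesgue_measure R]_(s in `[0%R, T]) (2^-1 * q w + B)%:E)%E.
  apply: lower_integral_le => // s; rewrite /= in_itv/= => sT.
  - exact: lagrangian_ge0.
  - by rewrite lee_fin addr_ge0// mulr_ge0// mass_inner_ge0.
  - by rewrite /lagrangian vg mass_norm_sqr EFinD leeD2l// UB.
rewrite integral_cst//= lebesgue_measure_itv/= lte_fin T0.
by rewrite -EFinB subr0 -EFinM mulrC.
Qed.

End dominated.

(** * Weak KAM solutions under translation *)

Section weak_KAM.
Hypothesis u_wKAM : weak_KAM ip m u.
Let u_dom : dominated ip m u := u_wKAM.1.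

(** The fixed-point equation is an infimum over starting points, then over curves; a strict
    inequality with margin [e] passes through both. *)
Lemma near_optimal_curve x (t e : R) : 0 < t -> 0 < e -> exists gamma,
  [/\ abs_continuous nrm 0 t gamma, gamma t = x &
      (action ip m 0 t gamma <= (u x - u (gamma 0%R) + e)%:E)%E].
Proof.
move=> t0 e0; have := u_wKAM.2 t (ltW t0) x.
rewrite /lax_oleinik (gt_eqF t0) => ux.
have : ((u x)%:E < (u x + e)%:E)%E by rewrite lte_fin ltrDl.
rewrite -{1}ux => /ereal_inf_lt[_ [y _ <-]].
rewrite -lteBrDl// => /ereal_inf_lt[_ [gamma [ac gy gx] <-] lt_a].
exists gamma; split => //; rewrite gy; apply: le_trans (ltW lt_a) _.
by rewrite -EFinB lee_fin addrAC.
Qed.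

(* Drifting a near-optimal curve linearly by [w] and by [- l *: w] leaves its
   potential energy unchanged and adds kinetic energy of order [1 / t]. *)
Lemma translation_concave x w (l : R) : (forall i j, w i = w j) -> 0 <= l ->
  l * u (x + w) + u (x - l *: w) <= (1 + l) * u x.
Proof.
move=> wc l0; apply/ler_addgt0Pr => e e0.
have l1 : 0 < 1 + l by apply: ltr_wpDr.
have qw := mass_inner_ge0 w.
(* The drifts will cost [l * (1 + l) * q w / (2 * t)], which this duration keeps below [e / 2]. *)
pose t := 1 + l * (1 + l) * q w / e.
have A0 : 0 <= l * (1 + l) * q w by rewrite !mulr_ge0// ltW.
have t0 : 0 < t by rewrite /t ltr_wpDr// divr_ge0// ltW.
(* Weighted by [1 + l], this margin becomes the other [e / 2]. *)
have e'0 : 0 < e / (2 * (1 + l)) by rewrite divr_gt0// mulr_gt0.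
have [gamma [ac gt act]] := near_optimal_curve x t0 e'0.
pose w' := t^-1 *: w.
have end_drift (b : R) :
    ((u (x + b *: w) - u (gamma 0))%:E <=
      action ip m 0 t (fun s => (gamma s + s *: (b *: w'))%R))%E.
  have := dominated_action u_dom t0 (abs_continuous_drift (b *: w') ac).
  by rewrite scale0r addr0 /w' !scalerA mulrAC divff ?gt_eqF// mul1r gt.
have potential_drift (b s : R) : U (gamma s + s *: (b *: w')) = U (gamma s).
  by apply: potential_translation => i j; rewrite !ffunE (wc i j).
pose c := l * (1 + l) / 2 * q w'.
have c0 : 0 <= c by rewrite !mulr_ge0 ?mass_inner_ge0 ?invr_ge0// ltW.
have mut : lebesgue_measure (`[0, t]%classic : set R) = t%:E.
  by rewrite lebesgue_measure_itv/= lte_fin t0 -EFinB subr0.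
have : l * (u (x + 1 *: w) - u (gamma 0)) + (u (x + (- l) *: w) - u (gamma 0))
    <= (1 + l) * (u x - u (gamma 0) + e / (2 * (1 + l))) + c * t.
  pose L gam s := lagrangian ip m (gam s) (velocity nrm gam s).
  have L0 gam s : `[0, t]%classic s -> (0 <= L gam s)%E.
    by move=> _; exact: lagrangian_ge0.
  apply: (@lower_integral_convex _ _ R lebesgue_measure `[0, t]%classic
    (L (fun s => gamma s + s *: (1 *: w')))
    (L (fun s => gamma s + s *: ((- l) *: w'))) (L gamma)
    l c _ _ _ t (measurable_itv _) mut
    (L0 _) (L0 _) (L0 _) l0 c0 _ (end_drift 1) (end_drift (- l)) act).
  move=> s _; apply: lagrangian_convex; [by []| | |].
  - exact: potential_drift.
  - exact: potential_drift.
  rewrite scale1r scaleNr; apply: le_trans (velocity_drift_convex _ _ _ l0) _.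
  by rewrite /c; lra.
have ct : c * t <= e / 2.
  have -> : c * t = l * (1 + l) * q w / 2 / t.
    by rewrite /c mass_innerZ; field; rewrite gt_eqF.
  have te : e / 2 * t = e / 2 + l * (1 + l) * q w / 2.
    by rewrite /t; field; rewrite gt_eqF.
  by rewrite ler_pdivrMr// te lerDr ltW// divr_gt0.
have e2 : (1 + l) * (e / (2 * (1 + l))) = e / 2.
  by field; rewrite gt_eqF.
rewrite scale1r scaleNr; move: e2 ct.
move: (e / (2 * _)) (c * t) => e' c' e2 ct; lra.
Qed.

(* A concave function bounded below by a sublinear one along each line cannot
   increase in any direction. *)
Lemma translation_nonincreasing x w : (forall i j, w i = w j) ->
  (forall e, 0 < e -> exists C, forall l, 0 <= l ->
    u x - e * l - C <= u (x - l *: w)) ->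
  u (x + w) <= u x.
Proof.
move=> wc sub; apply/ler_addgt0Pr => e e0.
have e20 : 0 < e / 2 by rewrite divr_gt0.
have [C subC] := sub _ e20.
(* Makes [C] at most [l * (e / 2)], so that after division by [l] the total error is at most [e]. *)
pose l := 1 + `|C| / (e / 2).
have l0 : 0 < l by rewrite /l ltr_wpDr// divr_ge0// ltW.
have le2 : l * (e / 2) = e / 2 + `|C|.
  by rewrite mulrDl mul1r divfK// gt_eqF.
have := translation_concave x wc (ltW l0).
have := subC _ (ltW l0); have := ler_norm C => C_le subl conc.
by rewrite -(ler_pM2l l0); lra.
Qed.

(* Reach [x] from [x - l *: w] by dilating by [1 + k], translating, contracting
   back; the translation costs at most [e * l] because the potential energy
   along it is divided by [1 + k]. *)
Lemma translation_le_noncollision x w : (forall i j, w i = w j) ->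
  (U x < +oo)%E -> u (x + w) <= u x.
Proof.
move=> wc; have := potential_ge0 x; case Ux : (U x) => [P| |]// P0 _.
rewrite lee_fin in P0.
apply: translation_nonincreasing => // e e0.
have qw := mass_inner_ge0 w.
(* The translation by [l *: w] takes time [l * s]: [s] keeps its kinetic cost and [k] its potential
   cost below [l * (e / 2)] each. *)
pose s := 1 + q w / e; pose k := 2 * s * P / e.
have s0 : 0 < s by rewrite /s ltr_wpDr// divr_ge0// ltW.
have k0 : 0 <= k by rewrite /k divr_ge0 ?mulr_ge0// ltW.
(* The cost of dilating and contracting, each in unit time, where the potential stays at most
   [P]. *)
pose C := q (k *: x) + 2 * P.
have dilate (a : R) (z : config) : 0 <= a -> (forall i j, z i = z j) ->
    U ((1 + a) *: x + z) = (P / (1 + a))%:E.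
  move=> a0 zc; rewrite potential_translation// potentialZ ?ltr_wpDr// Ux.
  by rewrite -EFinM mulrC.
have dilate_le (a : R) (z : config) : 0 <= a -> (forall i j, z i = z j) ->
    (U ((1 + a) *: x + z)%R <= P%:E)%E.
  move=> a0 zc; rewrite dilate// lee_fin ler_pdivrMr ?ltr_wpDr//.
  by rewrite mulrDr mulr1 lerDl mulr_ge0.
have lwc (c : R) i j : (c *: w) i = (c *: w) j by rewrite !ffunE (wc i j).
exists C => l l0.
have away : u ((1 + k) *: x - l *: w) - u (x - l *: w) <= 2^-1 * q (k *: x) + P.
  have := dominated_line u_dom (T := 1) (B := P)
    (x := x - l *: w) (w := k *: x).
  rewrite scale1r mul1r scalerDl scale1r addrAC; apply=> // r /andP[r0 _].
  rewrite addrAC scalerA -[X in X + _ *: x]scale1r -scalerDl -scaleNr.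
  by apply: dilate_le; [exact: mulr_ge0 | exact: lwc].
have back : u x - u ((1 + k) *: x) <= 2^-1 * q (k *: x) + P.
  have := dominated_line u_dom (T := 1) (B := P) (x := (1 + k) *: x)
    (w := (- k) *: x).
  rewrite scale1r mul1r !mass_innerZ sqrrN -scalerDl addrK scale1r.
  apply=> // r /andP[r0 r1]; rewrite scalerA -scalerDl -addrA.
  have -> : k + r * - k = (1 - r) * k by ring.
  rewrite -[_ *: x]addr0; apply: dilate_le.
    by rewrite mulr_ge0// subr_ge0.
  by move=> i j; rewrite !ffunE.
have across : u ((1 + k) *: x) - u ((1 + k) *: x - l *: w) <= e * l.
  (* [l = 0] is separate: [dominated_line] asks for a positive duration. *)
  move: l0; rewrite le_eqVlt => /predU1P[<-|l0].
    by rewrite scale0r subr0 subrr mulr0.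
  have := dominated_line u_dom (T := l * s) (B := P / (1 + k))
    (x := (1 + k) *: x - l *: w) (w := s^-1 *: w).
  rewrite scalerA mulfK ?gt_eqF// subrK => /(_ (mulr_gt0 l0 s0)) H.
  apply: le_trans (H _) _ => [r _|].
    by rewrite -addrA -scaleNr scalerA -scalerDl dilate.
  rewrite mass_innerZ [e * l]mulrC -mulrA ler_pM2l// mulrDr.
  have -> : s * (2^-1 * (s^-1 ^+ 2 * q w)) = q w / s / 2.
    by field; rewrite gt_eqF.
  have h1 : q w / s <= e.
    by rewrite ler_pdivrMr// mulrDr mulr1 mulrC divfK ?gt_eqF// lerDr ltW.
  have h2 : s * (P / (1 + k)) <= e / 2.
    rewrite mulrA ler_pdivrMr ?ltr_wpDr// mulrDr mulr1.
    have -> : e / 2 * k = s * P by rewrite /k; field; rewrite gt_eqF.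
    by rewrite lerDr divr_ge0// ltW.
  lra.
rewrite /C; lra.
Qed.

(** Otherwise the Lagrangian is infinite on an open interval of positive length. Taking [s] inside
    makes [[0, s]] a genuine time interval. *)
Lemma finite_action_noncollision (t : R) gamma : 0 < t ->
  (action ip m 0 t gamma < +oo)%E ->
  exists2 s, 0 < s < t & (U (gamma s) < +oo)%E.
Proof.
move=> t0 act; apply: contrapT => nU.
suff : (+oo <= action ip m 0 t gamma)%E by rewrite leNgt act.
have := @integral_cst _ _ R lebesgue_measure `]0, t[%classic
  (measurable_itv _) +oo%E.
rewrite /= lebesgue_measure_itv/= lte_fin t0 -EFinB subr0.
rewrite gt0_mulye ?lte_fin// => <-.
apply: lower_integral_le => // s; rewrite /= in_itv/= => st.
- by apply: (@subset_itv_oo_cc _ _ 0 t); rewrite /= in_itv.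
- exact: lagrangian_ge0.
rewrite /lagrangian; have -> : U (gamma s) = +oo%E.
  by apply/eqP; rewrite -leye_eq leNgt; apply/negP => Us; apply: nU; exists s.
by rewrite addey.
Qed.

(* [u] is already known to be invariant along the non-collision configuration
   [gamma s], so it is bounded below on the translates of [gamma 0]. *)
Lemma translation_le_start (t A : R) gamma w : (forall i j, w i = w j) ->
  0 < t -> abs_continuous nrm 0 t gamma ->
  (action ip m 0 t gamma <= A%:E)%E -> u (gamma 0 + w) <= u (gamma 0).
Proof.
move=> wc t0 ac act.
have [|s /andP[s0 st] Us] := finite_action_noncollision t0 _ (gamma := gamma).
  exact: le_lt_trans act (ltry _).
apply: translation_nonincreasing => // e e0.
exists (u (gamma 0) - u (gamma s) + A) => l l0.
have lwc i j : (- (l *: w)) i = (- (l *: w)) j by rewrite !ffunE (wc i j).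
have lwc' i j : (l *: w) i = (l *: w) j by rewrite !ffunE (wc i j).
have us : u (gamma s) <= u (gamma s - l *: w).
  rewrite -{1}(subrK (l *: w) (gamma s)).
  apply: translation_le_noncollision => //.
  by rewrite potential_translation.
have acs := abs_continuous_sub (ltW st) ac.
have := dominated_action u_dom s0 (abs_continuous_translation (- (l *: w)) acs).
rewrite action_translation// => us0.
(* The action up to time [s] is at most the whole action, the Lagrangian being nonnegative. *)
have : ((u (gamma s - l *: w) - u (gamma 0 - l *: w))%:E <= A%:E)%E.
  apply: le_trans us0 _; apply: le_trans act.
  apply: lower_integral_le => [r|r _|r _|//].
  - by rewrite /= !in_itv/= => /andP[-> /le_trans]; apply; exact: ltW.
  - exact: lagrangian_ge0.
  - exact: lagrangian_ge0.
rewrite lee_fin; have := mulr_ge0 (ltW e0) l0; lra.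
Qed.

(** The translate of a near-optimal curve has the same action and starts where [u] is no larger; any
    positive duration would do. *)
Lemma translation_le x w : (forall i j, w i = w j) -> u (x + w) <= u x.
Proof.
move=> wc; apply/ler_addgt0Pr => e e0.
have [gamma [ac <- act]] := near_optimal_curve x ltr01 e0.
have g0 := translation_le_start wc ltr01 ac act.
have := dominated_action u_dom ltr01 (abs_continuous_translation w ac).
rewrite action_translation// => /le_trans/(_ act); rewrite lee_fin; lra.
Qed.

End weak_KAM.
End mass_geometry.

Theorem theorem1 (R : realType) (E : vectType R) (ip : {dot E for idfun})
    (hE : (2 <= \dim {:E})%N)
    (N : nat) (hN : (2 <= N)%N) (m : 'I_N -> R) (hm : forall i, 0 < m i)
    (u : {ffun 'I_N -> E} -> R) (hu : weak_KAM ip m u) :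
  forall (x : {ffun 'I_N -> E}) (r : E), u x = u [ffun i => x i + r].
Proof.
move=> x r.
have -> : [ffun i => x i + r] = x + [ffun=> r].
  by apply/ffunP => i; rewrite !ffunE.
have rc (c : E) (i j : 'I_N) : [ffun=> c] i = [ffun=> c] j :> E.
  by rewrite !ffunE.
apply/le_anti/andP; split; last by apply: (translation_le hm hu); exact: rc.
(* The reverse inequality is a translation by the opposite vector. *)
rewrite -{1}(addrK [ffun=> r] x); apply: (translation_le hm hu) => i j.
by rewrite !ffunE.
Qed.
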